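(* Let $I\subset\mathbb{R}$ be an interval with interior $I^{\circ}$, let $f:I\to\mathbb{R}$ be twice differentiable on $I^{\circ}$, let $a,b\in I^{\circ}$ with $a<b$, and suppose $f''\in L_1[a,b]$. Let $q\ge1$ and suppose $|f''|^q$ is convex on $[a,b]$. Then $$\left|\frac{1}{b-a}\int_a^b f(x)\,dx-f\left(\frac{a+b}{2}\right)\right|\le\frac{(b-a)^2}{48}\left\{\left(\frac{3|f''(a)|^q+5|f''(b)|^q}{8}\right)^{1/q}+\left(\frac{5|f''(a)|^q+3|f''(b)|^q}{8}\right)^{1/q}\right\}.$$ If in addition $f'(a)=f'(b)$, then $$\left|\frac{1}{b-a}\int_a^b f(x)\,dx-\frac{f(a)+f(b)}{2}\right|\le\frac{(b-a)^2}{48}\left\{\left(\frac{|f''(a)|^q+7|f''(b)|^q}{8}\right)^{1/q}+\left(\frac{7|f''(a)|^q+|f''(b)|^q}{8}\right)^{1/q}\right\}.$$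
   Context: $L_1[a,b]$ denotes the space of Lebesgue integrable functions on $[a,b]$. *)

(* Defs.v *)
(* MathComp-Analysis *)
From mathcomp Require Export all_boot all_order all_algebra.
From mathcomp Require Export all_classical all_reals all_analysis.
Export Order.TTheory GRing.Theory Num.Theory.
Export numFieldNormedType.Exports.

(* Main.v *)
Require Import Defs.
From mathcomp Require Import ring lra.

(** Let [F] be a primitive of [f] and [h = d - c]. Everything rests on one
    estimate for the second-order Taylor remainder of [F]:

      |F d - F c - h f(c) - h^2/2 f'(c)|
         <= |h|^3/6 ((3 |f''(c)|^q + |f''(d)|^q) / 4)^(1/q),

    valid for [c], [d] in [[a, b]] in either order ([taylor2_convex]). The
    weights 3 and 1 appear because the remainder is the integral of [f'']
    against a kernel proportional to [(1 - t)^2], whose barycentre lies at a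
    quarter of the way from [c] to [d].

    Write [m] for the midpoint. Expanding [F] from [m] to [a] and to [b] and
    subtracting, the terms in [f'(m)] cancel and the two remainders bound the
    midpoint error. Expanding [F] from [a] and from [b] to [m] and subtracting,
    the terms in [f'] cancel when [f'(a) = f'(b)], and the two remainders bound
    the trapezoid error. Convexity at [m] replaces [|f''(m)|^q] by the mean of
    its values at [a] and [b], which turns the weights 3 and 1 into 3, 5 and
    1, 7 over 8.

    The estimate itself is usually obtained from the power mean inequality for
    integrals. Here that inequality is replaced by a pointwise one. Since
    [w |-> w^(1/q)] is concave, its tangent at the mean
    [W = (3 |f''(c)|^q + |f''(d)|^q) / 4] lies above it; together with convexity
    this bounds [|f''|] on the segment by an affine function whose value at the
    barycentre is exactly [W^(1/q)] ([affine_majorant]). Integrating an affine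
    bound on a third derivative three times needs only the mean value theorem
    ([dominated_increment], [taylor2_01]). *)

Local Open Scope ring_scope.
Local Open Scope classical_set_scope.

Lemma is_derive_quartic (R : realType) (c0 c1 c2 c3 c4 x : R) :
  is_derive x 1 (fun t : R => c0 + c1 * t + c2 * t ^+ 2 + c3 * t ^+ 3 + c4 * t ^+ 4)
    (c1 + 2 * c2 * x + 3 * c3 * x ^+ 2 + 4 * c4 * x ^+ 3).
Proof.
apply: is_derive_eq. rewrite /GRing.scale/=; ring.
Qed.

(** The functions [g - f] and [g + f] are nondecreasing. *)
Lemma dominated_increment (R : realType) (f df g dg : R -> R) (a b : R) :
  (forall x, x \in `[a, b]%R -> is_derive x 1 f (df x)) ->
  (forall x, x \in `[a, b]%R -> is_derive x 1 g (dg x)) ->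
  (forall x, x \in `[a, b]%R -> `|df x| <= dg x) ->
  forall x, x \in `[a, b]%R -> `|f x - f a| <= g x - g a.
Proof.
move=> df_f dg_g le_df x; rewrite in_itv/= => /andP[ax xb].
have inc (h dh : R -> R) : (forall x, x \in `[a, b]%R -> is_derive x 1 h (dh x)) ->
    (forall x, x \in `[a, b]%R -> 0 <= dh x) -> h a <= h x.
  move=> dh_h dh0.
  have sub y : y \in `[a, x]%R -> y \in `[a, b]%R.
    by rewrite !in_itv/= => /andP[-> /le_trans->].
  have h1 (y : R) : y \in `]a, x[%R -> is_derive y 1 h (dh y).
    by move=> /subset_itv_oo_cc/sub; exact: dh_h.
  have h2 : {within `[a, x], continuous h}.
    apply: derivable_within_continuous => y /sub /dh_h h'; exact: ex_derive.
  have [c cax] := MVT_segment ax h1 h2.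
    rewrite -subr_ge0 => ->; apply: mulr_ge0; last by rewrite subr_ge0.
    exact/dh0/sub.
have := inc (g - f) (fun x => dg x - df x).
have := inc (g + f) (fun x => dg x + df x).
rewrite !fctE => h1 h2.
have {}h1 : g a + f a <= g x + f x.
  apply: h1 => y yab.
    by have ? := df_f y yab; have ? := dg_g y yab; apply: is_derive_eq.
  by have := le_df y yab; rewrite ler_norml; lra.
have {}h2 : g a - f a <= g x - f x.
  apply: h2 => y yab.
    by have ? := df_f y yab; have ? := dg_g y yab; apply: is_derive_eq.
  by have := le_df y yab; rewrite ler_norml; lra.
by rewrite ler_norml; lra.
Qed.

(** If [W > 0], the affine function with values [u], [v] at 0, 1 is the tangent of
    [w |-> w `^ q^-1] at [W := (3 * A + B) / 4], composed with the affine
    interpolation of [A] and [B]. That interpolation takes the value [W] at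
    [t = 1/4], hence the equation on [u] and [v]. *)
Lemma affine_majorant (R : realType) (q A B : R) : 1 <= q -> 0 <= A -> 0 <= B ->
  exists u v : R, (3 * u + v) / 4 = ((3 * A + B) / 4) `^ q^-1 /\
    forall t y : R, 0 <= y -> y `^ q <= (1 - t) * A + t * B ->
      y <= (1 - t) * u + t * v.
Proof.
move=> q1 A0 B0; have q0 : 0 < q by lra.
have qn0 : q != 0 by rewrite gt_eqF.
set W := (3 * A + B) / 4; set c := W `^ q^-1.
have W0 : 0 <= W by rewrite /W; lra.
have cq : c `^ q = W by rewrite /c -powRrM mulVf ?powRr1.
have c0 : 0 <= c by exact: powR_ge0.
(* The tangent at 0 is vertical when 1 < q; but then A = B = 0 anyway. *)
have [W00|Wn0] := eqVneq W 0.
  exists 0, 0; split.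
    by rewrite /c W00 powR0 ?invr_eq0//; ring.
  move=> t y y0.
  have -> : A = 0 by move: W00; rewrite /W; lra.
  have -> : B = 0 by move: W00; rewrite /W; lra.
  rewrite !mulr0 addr0 => yq.
  have : y `^ q == 0 by rewrite eq_le yq powR_ge0.
  by rewrite powR_eq0 => /andP[/eqP-> _].
have cp : 0 < c by rewrite powR_gt0 // lt_neqAle eq_sym Wn0.
pose s := c `^ (q - 1).
have sp : 0 < s by exact: powR_gt0.
(* This is Young's inequality for y and c `^ (q - 1), divided by c `^ (q - 1). *)
have tangent y : 0 <= y -> y <= c + (q * s)^-1 * (y `^ q - W).
  move=> y0.
  have sc : s * c = W.
    by rewrite /s -{2}(powRr1 c0) -powRD ?subrK// gt_eqF// implybT.
  have young : q * (y * s) <= y `^ q + (q - 1) * W.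
    (* For q = 1 the conjugate exponent is infinite. *)
    have [qE|qn1] := eqVneq q 1.
      by rewrite /s qE subrr powRr0 powRr1// !mul0r mulr1 addr0 mul1r.
    have qm : 0 < q - 1 by rewrite subr_gt0 lt_neqAle eq_sym qn1.
    have qm0 : q - 1 != 0 by rewrite gt_eqF.
    have conj : q^-1 + (q / (q - 1))^-1 = 1 by field; exact/andP.
    have := conjugate_powR y0 (ltW sp) q0 (divr_gt0 q0 qm) conj.
    rewrite -powRrM (mulrCA _ q) divff// mulr1 cq.
    rewrite -(ler_pM2l q0) => /le_trans; apply.
    by rewrite le_eqVlt; apply/orP; left; apply/eqP; field; exact/andP.
  rewrite -(@ler_pM2l _ (q * s)) ?mulr_gt0//.
  rewrite mulrDr mulVKf ?gt_eqF ?mulr_gt0// -(mulrA q s c) sc.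
  have -> : q * s * y = q * (y * s) by ring.
  lra.
exists (c + (q * s)^-1 * (A - W)), (c + (q * s)^-1 * (B - W)); split.
  by rewrite /W; field; rewrite qn0 gt_eqF.
move=> t y y0 yW; apply: le_trans (tangent _ y0) _.
rewrite -subr_ge0 [leRHS](_ : _ = (q * s)^-1 * ((1 - t) * A + t * B - y `^ q)); last by ring.
by rewrite mulr_ge0 ?invr_ge0 ?mulr_ge0 ?(ltW q0) ?(ltW sp)// subr_ge0.
Qed.

(** The bound is the value at 1 of the third primitive of the affine bound on
    [F3], all primitives being taken to vanish at 0: three applications of
    [dominated_increment] climb from [F3] to [F]. *)
Lemma taylor2_01 (R : realType) (F F1 F2 F3 : R -> R) (u v : R) :
  (forall t : R, t \in `[0, 1]%R -> is_derive t 1 F (F1 t)) ->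
  (forall t : R, t \in `[0, 1]%R -> is_derive t 1 F1 (F2 t)) ->
  (forall t : R, t \in `[0, 1]%R -> is_derive t 1 F2 (F3 t)) ->
  (forall t : R, t \in `[0, 1]%R -> `|F3 t| <= (1 - t) * u + t * v) ->
  `|F 1 - F 0 - F1 0 - F2 0 / 2| <= (3 * u + v) / 24.
Proof.
move=> dF dF1 dF2 leF3.
pose Q (c0 c1 c2 c3 c4 t : R) :=
  c0 + c1 * t + c2 * t ^+ 2 + c3 * t ^+ 3 + c4 * t ^+ 4.
(* One integration of a polynomial bound; in each use,
   a1 + a2 * t is a Taylor polynomial of df at 0. *)
have step (f df : R -> R) (a1 a2 c1 c2 c3 c4 : R) :
    (forall t : R, t \in `[0, 1]%R -> is_derive t 1 f (df t)) ->
    (forall t : R, t \in `[0, 1]%R -> `|df t - (a1 + a2 * t)| <= Q c1 (2 * c2) (3 * c3) (4 * c4) 0 t) ->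
    forall t : R, t \in `[0, 1]%R -> `|f t - (f 0 + a1 * t + a2 / 2 * t ^+ 2)| <= Q 0 c1 c2 c3 c4 t.
  move=> df_f le t t01.
  have dQ := is_derive_quartic R (f 0) a1 (a2 / 2) 0 0.
  have dr (x : R) : x \in `[0, 1]%R ->
      is_derive x 1 (f - Q (f 0) a1 (a2 / 2) 0 0) (df x - (a1 + a2 * x)).
    move=> x01; have ? := df_f x x01; have ? := dQ x.
    by apply: is_derive_eq; field.
  have := dominated_increment R _ _ _ _ 0 1 dr
    (fun x _ => is_derive_quartic R 0 c1 c2 c3 c4 x) _ t t01.
  rewrite /Q !fctE !expr0n/= !(mul0r, mulr0) !addr0 subrr !subr0 !add0r.
  apply=> x x01; apply: le_trans (le x x01) _.
  by rewrite /Q mul0r addr0.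
have eQ (x y : R) : x = y -> x <= y by move=> ->.
have s2 t (t01 : t \in `[0, 1]%R) :
    `|F2 t - F2 0| <= Q 0 u ((v - u) / 2) 0 0 t.
  have := step F2 F3 0 0 u ((v - u) / 2) 0 0 dF2 _ t t01.
  rewrite !mul0r mulr0 !addr0; apply=> x x01.
  rewrite mul0r addr0 subr0; apply: le_trans (leF3 x x01) _.
  by apply: eQ; rewrite /Q; field.
have s1 t (t01 : t \in `[0, 1]%R) :
    `|F1 t - (F1 0 + F2 0 * t)| <= Q 0 0 (u / 2) ((v - u) / 6) 0 t.
  have := step F1 F2 (F2 0) 0 0 (u / 2) ((v - u) / 6) 0 dF1 _ t t01.
  rewrite !mul0r !addr0; apply=> x x01.
  rewrite mul0r addr0; apply: le_trans (s2 x x01) _.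
  by apply: eQ; rewrite /Q; field.
have t11 : (1 : R) \in `[0, 1]%R by rewrite in_itv/= ler01 lexx.
have := step F F1 (F1 0) (F2 0) 0 0 (u / 6) ((v - u) / 24) dF _ 1 t11.
rewrite (_ : F 1 - _ = F 1 - F 0 - F1 0 - F2 0 / 2); last by field.
rewrite (_ : Q _ _ _ _ _ 1 = (3 * u + v) / 24); last by rewrite /Q; field.
apply=> x x01; apply: le_trans (s1 x x01) _.
by apply: eQ; rewrite /Q; field.
Qed.

(** Allowing [d < c] lets one Taylor estimate serve for expansions to the left
    and to the right. *)
Lemma convex_function_segment (R : realType) (g : R -> R) (a b c d t : R) :
  convex_function `[a, b] g -> c \in `[a, b]%R -> d \in `[a, b]%R -> 0 <= t <= 1 ->
  g (c + (d - c) * t) <= (1 - t) * g c + t * g d.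
Proof.
move=> cvx cab dab /andP[t0 t1].
have := cvx (Itv01 t0 t1) d c; rewrite !inE/= => /(_ dab cab).
have -> : conv (Itv01 t0 t1) (d : convex_lmodType R) (c : convex_lmodType R) = c + (d - c) * t.
  rewrite /= [LHS](@convRE R d c (Itv01 t0 t1))/= /unstable.onem; ring.
by rewrite [leRHS](@convRE R (g d) (g c) (Itv01 t0 t1)) [leRHS]addrC.
Qed.

(** The Taylor remainder is studied along [t |-> c + (d - c) * t], so that both
    signs of [d - c] reduce to [taylor2_01]. *)
Lemma taylor2_convex (R : realType) (F f f1 f2 : R -> R) (a b q c d : R) :
  1 <= q ->
  (forall x, x \in `[a, b]%R -> is_derive x 1 F (f x)) ->
  (forall x, x \in `[a, b]%R -> is_derive x 1 f (f1 x)) ->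
  (forall x, x \in `[a, b]%R -> is_derive x 1 f1 (f2 x)) ->
  convex_function `[a, b] (fun x : R => `|f2 x| `^ q) ->
  c \in `[a, b]%R -> d \in `[a, b]%R ->
  `|F d - F c - (d - c) * f c - (d - c) ^+ 2 / 2 * f1 c| <=
    `|d - c| ^+ 3 / 6 * ((3 * `|f2 c| `^ q + `|f2 d| `^ q) / 4) `^ q^-1.
Proof.
move=> q1 dF df df1 cvx cab dab.
set h := d - c.
pose p (t : R) := c + h * t.
have pab t : t \in `[0, 1]%R -> p t \in `[a, b]%R.
  move: cab dab; rewrite /p /h !in_itv/= => /andP[ac cb] /andP[ad db] /andP[t0 t1].
  apply/andP; split; nra.
have dp (t : R) : is_derive t 1 p h.
  by apply: is_derive_eq; rewrite /GRing.scale/=; ring.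
(* Each derivative of F (p t) brings out a factor h; k collects the earlier
   ones. *)
have dcomp (k : R) (G g : R -> R) :
    (forall x, x \in `[a, b]%R -> is_derive x 1 G (g x)) ->
    forall t : R, t \in `[0, 1]%R ->
      is_derive t 1 (fun t => k * G (p t)) (k * h * g (p t)).
  move=> dG t /pab /dG dGt; have ? := is_derive1_comp dGt (dp t).
  apply: (is_derive_eq (f := k *: (G \o p))).
  by rewrite /GRing.scale/=; ring.
have [u [v [uvE maj]]] :=
  affine_majorant R q (`|f2 c| `^ q) (`|f2 d| `^ q) q1 (powR_ge0 _ _) (powR_ge0 _ _).
have := taylor2_01 R (fun t => 1 * F (p t)) (fun t => 1 * h * f (p t))
  (fun t => 1 * h * h * f1 (p t)) (fun t => 1 * h * h * h * f2 (p t))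
  (`|h| ^+ 3 * u) (`|h| ^+ 3 * v) (dcomp _ _ _ dF) (dcomp _ _ _ df) (dcomp _ _ _ df1).
have -> : p 0 = c by rewrite /p mulr0 addr0.
have -> : p 1 = d by rewrite /p /h mulr1 addrC subrK.
rewrite -uvE => H.
rewrite (_ : _ - _ = 1 * F d - 1 * F c - 1 * h * f c - 1 * h * h * f1 c / 2); last by field.
rewrite (_ : `|h| ^+ 3 / 6 * _ = (3 * (`|h| ^+ 3 * u) + `|h| ^+ 3 * v) / 24); last by field.
apply: H => t t01.
rewrite !normrM normr1 (_ : _ + _ = `|h| ^+ 3 * ((1 - t) * u + t * v)); last by ring.
rewrite (_ : 1 * _ * _ * _ = `|h| ^+ 3); last by ring.
apply: ler_wpM2l; first exact: exprn_ge0.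
have t01' : 0 <= t <= 1 by move: t01; rewrite in_itv.
apply: maj => //.
by have := convex_function_segment R _ a b c d t cvx cab dab t01'.
Qed.

(** Continuity on the larger segment [[a', b']] makes the primitive
    differentiable, on both sides, at the endpoints [a] and [b] too. *)
Lemma continuous_antiderivative (R : realType) (f : R -> R) (a' a b b' : R) :
  a' < a -> a <= b -> b < b' ->
  (forall x, x \in `[a', b']%R -> {for x, continuous f}) ->
  exists F : R -> R, (forall x, x \in `[a, b]%R -> is_derive x 1 F (f x)) /\
    \int[lebesgue_measure]_(x in `[a, b]) f x = F b - F a.
Proof.
move=> a'a ab bb' cf.
have fi : lebesgue_measure.-integrable `[a', b'] (EFin \o f).
  apply: continuous_compact_integrable; first exact: segment_compact.
  by apply: continuous_in_subspaceT => x; rewrite inE; exact: cf.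
exists (fun y => \int[lebesgue_measure]_(t in `[a', y]) f t); split.
  move=> x; rewrite in_itv/= => /andP[ax xb].
  have a'x := lt_le_trans a'a ax; have xb' := le_lt_trans xb bb'.
  have [|dF F'] := continuous_FTC1_closed xb' fi a'x.
    by apply: cf; rewrite in_itv/= (ltW a'x) (ltW xb').
  by apply: DeriveDef; [exact: dF|rewrite -derive1E; exact: F'].
have sub (x y : R) : a' <= x -> y <= b' -> `[x, y]%classic `<=` `[a', b']%classic.
  by move=> ax yb; apply: subset_itv; rewrite bnd_simp.
have fab : lebesgue_measure.-integrable `[a', b] (EFin \o f).
  by apply: integrableS fi => //; apply: sub => //; exact: ltW.
rewrite Rintegral_itvB //= ?bnd_simp ?(ltW a'a)//.
rewrite Rintegral_itv_obnd_cbnd//.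
by apply: integrableS fab => //; apply: subset_itv; rewrite bnd_simp// ltW.
Qed.

Lemma interior_enlarge_segment (R : realType) (I : set R) (a b : R) :
  is_interval I -> I° a -> I° b ->
  exists a' b' : R, [/\ a' < a, b < b' & forall x, x \in `[a', b']%R -> I° x].
Proof.
move=> hI /nbhs_ballP[e/= e0 ae] /nbhs_ballP[e'/= e'0 be'].
have Ia : I (a - e / 2) by apply: ae; rewrite /ball/= opprB addrC subrK gtr0_norm; lra.
have Ib : I (b + e' / 2).
  apply: be'; rewrite /ball/= opprD addrA subrr sub0r normrN gtr0_norm; lra.
exists (a - e / 4), (b + e' / 4); split; [lra|lra|move=> x].
rewrite in_itv/= => /andP[ax xb].
have /(_ x) : `]a - e / 2, b + e' / 2[%classic `<=` I°.
  rewrite -open_subsetE; last exact: interval_open.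
  move=> y /=; rewrite in_itv/= => /andP[ay yb].
  by apply: (hI _ _ Ia Ib); rewrite (ltW ay) (ltW yb).
by apply; rewrite /= in_itv/=; apply/andP; split; lra.
Qed.

(** The two error bounds with the integral of [f] written as [F b - F a], and
    with the successive derivatives of [F] as arbitrary functions. *)
Lemma midpoint_trapezoid_primitive (R : realType) (F f f1 f2 : R -> R) (a b q : R) :
  a < b -> 1 <= q ->
  (forall x, x \in `[a, b]%R -> is_derive x 1 F (f x)) ->
  (forall x, x \in `[a, b]%R -> is_derive x 1 f (f1 x)) ->
  (forall x, x \in `[a, b]%R -> is_derive x 1 f1 (f2 x)) ->
  convex_function `[a, b] (fun x : R => `|f2 x| `^ q) ->
  `|(b - a)^-1 * (F b - F a) - f ((a + b) / 2)| <= (b - a) ^+ 2 / 48 *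
       (((3 * `|f2 a| `^ q + 5 * `|f2 b| `^ q) / 8) `^ q^-1 +
        ((5 * `|f2 a| `^ q + 3 * `|f2 b| `^ q) / 8) `^ q^-1) /\
  (f1 a = f1 b ->
   `|(b - a)^-1 * (F b - F a) - (f a + f b) / 2| <= (b - a) ^+ 2 / 48 *
        (((`|f2 a| `^ q + 7 * `|f2 b| `^ q) / 8) `^ q^-1 +
         ((7 * `|f2 a| `^ q + `|f2 b| `^ q) / 8) `^ q^-1)).
Proof.
move=> hab hq dF df df1 hconv.
have aab : a \in `[a, b]%R by rewrite in_itv/= lexx ltW.
have bab : b \in `[a, b]%R by rewrite in_itv/= lexx ltW.
set m := (a + b) / 2.
have mab : m \in `[a, b]%R by rewrite /m in_itv/=; apply/andP; split; lra.
have taylor c d (cab : c \in `[a, b]%R) (dab : d \in `[a, b]%R) :=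
  taylor2_convex R F f f1 f2 a b q c d hq dF df df1 hconv cab dab.
set A := `|f2 a| `^ q; set B := `|f2 b| `^ q.
have A0 : 0 <= A by exact: powR_ge0.
have B0 : 0 <= B by exact: powR_ge0.
have Am : `|f2 m| `^ q <= (A + B) / 2.
  have h : 0 <= (1 / 2 : R) <= 1.
    apply/andP; split; lra.
  have := convex_function_segment R _ a b a b (1 / 2) hconv aab bab h.
  rewrite -/A -/B (_ : a + _ = m); last by rewrite /m; field.
  by rewrite (_ : (1 - 1 / 2) * A + _ = (A + B) / 2); last by field.
have M0 : 0 <= `|f2 m| `^ q by exact: powR_ge0.
(* Each expansion covers half of [[a, b]]: |d - c|^3 / 6 = (b - a)^3 / 48. *)
have step c d X : c \in `[a, b]%R -> d \in `[a, b]%R -> `|d - c| = (b - a) / 2 ->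
    (3 * `|f2 c| `^ q + `|f2 d| `^ q) / 4 <= X ->
    `|F d - F c - (d - c) * f c - (d - c) ^+ 2 / 2 * f1 c| <=
      (b - a) ^+ 3 / 48 * X `^ q^-1.
  move=> cab dab dc leX; apply: le_trans (taylor c d cab dab) _; rewrite dc.
  rewrite (_ : _ ^+ 3 / 6 = (b - a) ^+ 3 / 48); last by field.
  have N0 : 0 <= (3 * `|f2 c| `^ q + `|f2 d| `^ q) / 4.
    by rewrite divr_ge0 ?addr_ge0 ?mulr_ge0 ?powR_ge0.
  apply: ler_wpM2l.
    by rewrite divr_ge0 ?exprn_ge0// subr_ge0 ltW.
  by apply: ge0_ler_powR; rewrite ?invr_ge0 ?nnegrE// ?(le_trans N0 leX)//; lra.
have average (y S : R) : `|F b - F a - (b - a) * y| <= (b - a) ^+ 3 / 48 * S ->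
    `|(b - a)^-1 * (F b - F a) - y| <= (b - a) ^+ 2 / 48 * S.
  have ba0 : 0 < b - a by rewrite subr_gt0.
  have ban0 : b - a != 0 by rewrite gt_eqF.
  move=> le; rewrite -(ler_pM2l ba0) -{1}(gtr0_norm ba0) -normrM.
  rewrite mulrBr mulVKf//; apply: le_trans le _.
  by rewrite le_eqVlt; apply/orP; left; apply/eqP; field.
have ma : `|a - m| = (b - a) / 2 by rewrite ltr0_norm /m; lra.
have mb : `|b - m| = (b - a) / 2 by rewrite gtr0_norm /m; lra.
split=> [|f1ab].
  apply: average => //.
  have h1 := step m b ((3 * A + 5 * B) / 8) mab bab mb.
  have h2 := step m a ((5 * A + 3 * B) / 8) mab aab ma.
  have {}h1 := h1 ltac:(rewrite -/B; lra).
  have {}h2 := h2 ltac:(rewrite -/A; lra).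
  rewrite (_ : _ - _ = (F b - F m - (b - m) * f m - (b - m) ^+ 2 / 2 * f1 m) -
    (F a - F m - (a - m) * f m - (a - m) ^+ 2 / 2 * f1 m)); last by rewrite /m; field.
  by rewrite mulrDr; apply: le_trans (ler_normB _ _) _; exact: lerD.
apply: average => //.
have h1 := step b m ((A + 7 * B) / 8) bab mab.
have h2 := step a m ((7 * A + B) / 8) aab mab.
have {}h1 := h1 ltac:(by rewrite distrC) ltac:(rewrite -/B; lra).
have {}h2 := h2 ltac:(by rewrite distrC) ltac:(rewrite -/A; lra).
rewrite (_ : _ - _ = (F m - F a - (m - a) * f a - (m - a) ^+ 2 / 2 * f1 a) -
  (F m - F b - (m - b) * f b - (m - b) ^+ 2 / 2 * f1 b)).
  by rewrite mulrDr [leRHS]addrC; apply: le_trans (ler_normB _ _) _; exact: lerD.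
by rewrite f1ab /m; field.
Qed.

Theorem corollary4 (R : realType) (I : set R) (f : R -> R) (a b q : R)
    (hI : is_interval I)
    (hf1 : forall x : R, I° x -> derivable f x 1)
    (hf2 : forall x : R, I° x -> derivable f^`() x 1)
    (ha : I° a) (hb : I° b) (hab : a < b)
    (hL1 : lebesgue_measure.-integrable `[a, b] (EFin \o f^`(2)))
    (hq : 1 <= q)
    (hconv : convex_function `[a, b] (fun x : R => `|f^`(2) x| `^ q)) :
  `| (b - a)^-1 * (\int[lebesgue_measure]_(x in `[a, b]) f x)
     - f ((a + b) / 2) |
    <= (b - a) ^+ 2 / 48 *
       (((3 * `|f^`(2) a| `^ q + 5 * `|f^`(2) b| `^ q) / 8) `^ q^-1 +
        ((5 * `|f^`(2) a| `^ q + 3 * `|f^`(2) b| `^ q) / 8) `^ q^-1)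
  /\
  (f^`() a = f^`() b ->
   `| (b - a)^-1 * (\int[lebesgue_measure]_(x in `[a, b]) f x)
      - (f a + f b) / 2 |
     <= (b - a) ^+ 2 / 48 *
        (((`|f^`(2) a| `^ q + 7 * `|f^`(2) b| `^ q) / 8) `^ q^-1 +
         ((7 * `|f^`(2) a| `^ q + `|f^`(2) b| `^ q) / 8) `^ q^-1)).
Proof.
have [a' [b' [a'a bb' Iab']]] := interior_enlarge_segment R I a b hI ha hb.
have Iab x : x \in `[a, b]%R -> I° x.
  by rewrite in_itv/= => /andP[? ?]; apply: Iab'; rewrite in_itv/=; apply/andP; split; lra.
have cf x : x \in `[a', b']%R -> {for x, continuous f}.
  by move=> /Iab' /hf1 /derivable1_diffP; exact: differentiable_continuous.
have [F [dF ->]] := continuous_antiderivative R f a' a b b' a'a (ltW hab) bb' cf.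
have df x (xab : x \in `[a, b]%R) : is_derive x 1 f (f^`() x).
  by rewrite derive1E; exact/derivableP/hf1/Iab.
have df1 x (xab : x \in `[a, b]%R) : is_derive x 1 f^`() (f^`(2) x).
  by rewrite derive1nS derive1n1 derive1E; exact/derivableP/hf2/Iab.
have [mid trap] := midpoint_trapezoid_primitive R F f f^`() f^`(2) a b q
  hab hq dF df df1 hconv.
by split.
Qed.
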